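(* Let $F$ be a field. Then $F$ has the Neukirch–Uchida property if and only if $F$ is hyperrigid.
   Context: For a field $E$ with separable closure $E^{\mathrm{sep}}$, $\mathrm{Gal}(E^{\mathrm{sep}}/E)$ is the absolute Galois group, a profinite group; $G_F=\mathrm{Gal}(F^{\mathrm{sep}}/F)$. Given extensions $E_1,E_2$ of $F$ with separable closures $E_1^{\mathrm{sep}},E_2^{\mathrm{sep}}$, let $\mathrm{Iso}_F(E_1^{\mathrm{sep}}/E_1,E_2^{\mathrm{sep}}/E_2)$ be the set of field isomorphisms $\alpha:E_1^{\mathrm{sep}}\to E_2^{\mathrm{sep}}$ with $\alpha(E_1)=E_2$ and $\alpha|_F=\mathrm{id}_F$. Each such $\alpha$ induces an isomorphism $\alpha_*:\mathrm{Gal}(E_1^{\mathrm{sep}}/E_1)\to\mathrm{Gal}(E_2^{\mathrm{sep}}/E_2)$, $\alpha_*(g)(x)=\alpha(g(\alpha^{-1}(x)))$. $F$ has the Neukirch–Uchida property if for all finite separable extensions $E_1/F$ and $E_2/F$ and every isomorphism of profinite groups $\sigma:\mathrm{Gal}(E_1^{\mathrm{sep}}/E_1)\to\mathrm{Gal}(E_2^{\mathrm{sep}}/E_2)$ there exists a unique $\alpha\in\mathrm{Iso}_F(E_1^{\mathrm{sep}}/E_1,E_2^{\mathrm{sep}}/E_2)$ with $\sigma=\alpha_*$. Commensurator of a profinite group $G$: a virtual automorphism of $G$ is a topological isomorphism between two open subgroups of $G$; two are equivalent if they coincide on some open subgroup; the equivalence classes form, under composition (after restricting to suitable open subgroups),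 a group $\mathrm{Comm}(G)$. For an open subgroup $U$ of $G$, $\iota_U:U\to\mathrm{Comm}(G)$ sends $g$ to the class of $x\mapsto gxg^{-1}$. $\mathrm{Comm}(G)_S$ denotes $\mathrm{Comm}(G)$ with the strong topology: the unique group topology for which $\{\iota_U(U): U \text{ open subgroup of } G\}$ is a base of neighborhoods of $1$. The field $F$ is hyperrigid if the canonical map $\iota_{G_F}:G_F\to\mathrm{Comm}(G_F)_S$ is an isomorphism. Equivalently, $G_F$ is a hyperrigid topological group: for every topological isomorphism $\phi:U\to V$ between open subgroups of $G_F$ there is a unique $g\in G_F$ with $\phi(x)=gxg^{-1}$ for all $x\in U$. *)

(* Defs.v *)
From HB Require Import structures.
From mathcomp Require Import all_boot all_algebra all_field generic_quotient.
From mathcomp Require Import boolp classical_sets functions filter topology.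

Set Implicit Arguments.
Unset Strict Implicit.
Unset Printing Implicit Defensive.

Import GRing.Theory.
Local Open Scope classical_set_scope.

HB.mixin Record Group_isTopGroup G & Topological G & Group G := {
  mulg_continuous : continuous (fun z : G * G => (z.1 * z.2)%g);
  invg_continuous : continuous (fun x : G => (x^-1)%g)
}.

#[short(type="topGroupType")]
HB.structure Definition TopGroup :=
  {G of Topological G & Group G & Group_isTopGroup G}.

Definition topgroup_iso (G H : topGroupType) (f : G -> H) : Prop :=
  [/\ {morph f : x y / (x * y)%g}, continuous f &
      exists2 g : H -> G, cancel f g /\ cancel g f & continuous g].

Section OpenSubgroups.
Local Open Scope group_scope.
Variable G : topGroupType.
Implicit Types (U V W : set G) (x y g : G).

Definition open_subgroup U : Prop :=
  [/\ open U, U 1 & forall x y, U x -> U y -> U (x * y^-1)].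

Lemma open_subgroupV U x : open_subgroup U -> U x -> U x^-1.
Proof. by case=> _ U1 Ud Ux; rewrite -[x^-1]mul1g; apply: Ud. Qed.

Lemma open_subgroupM U x y : open_subgroup U -> U x -> U y -> U (x * y).
Proof.
move=> sU Ux /(open_subgroupV sU) Uy; case: (sU) => _ _ Ud.
by rewrite -[y]invgK; apply: Ud.
Qed.

Lemma open_subgroupT : open_subgroup setT.
Proof. by split=> //; exact: openT. Qed.

Lemma open_subgroupI U V :
  open_subgroup U -> open_subgroup V -> open_subgroup (U `&` V).
Proof.
move=> [oU U1 Ud] [oV V1 Vd]; split; [exact: openI | by [] |].
by move=> x y [Ux Vx] [Uy Vy]; split; [apply: Ud | apply: Vd].
Qed.

(* [phi] is only relevant on [U]; [{within _, continuous _}] is continuity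
   for the subspace topology, and ['pinv_(fun=> 1) U phi] is the inverse of
   [phi : U -> V], extended by 1 outside [V]. *)
Definition is_virtual_aut U V (phi : G -> G) : Prop :=
  [/\ open_subgroup U, open_subgroup V, set_bij U V phi,
      forall x y, U x -> U y -> phi (x * y) = phi x * phi y &
      {within U, continuous phi} /\
      {within V, continuous ('pinv_(fun=> 1) U phi)}].

End OpenSubgroups.

Record virtual_aut (G : topGroupType) := VirtualAut {
  vdom : set G;
  vcod : set G;
  vfun :> G -> G;
  virtual_autP : is_virtual_aut vdom vcod vfun
}.

HB.instance Definition _ (G : topGroupType) := gen_eqMixin (virtual_aut G).
HB.instance Definition _ (G : topGroupType) := gen_choiceMixin (virtual_aut G).

Section VirtualAut.
Local Open Scope group_scope.
Variable G : topGroupType.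
Implicit Types (U V W : set G) (x y g : G) (p q r : virtual_aut G).

Definition virtual_inv p : G -> G := 'pinv_(fun=> 1) (vdom p) p.

Lemma vdomP p : open_subgroup (vdom p). Proof. by case: (virtual_autP p). Qed.
Lemma vcodP p : open_subgroup (vcod p). Proof. by case: (virtual_autP p). Qed.

Lemma vfun_cod p x : vdom p x -> vcod p (p x).
Proof. by case: (virtual_autP p) => _ _ [+ _ _] _ _; apply. Qed.

Lemma vfunM p x y : vdom p x -> vdom p y -> p (x * y) = p x * p y.
Proof. by case: (virtual_autP p) => _ _ _ + _; apply. Qed.

Lemma vfunK p x : vdom p x -> virtual_inv p (p x) = x.
Proof.
case: (virtual_autP p) => _ _ [_ pI _] _ _ px.
by apply: (pinvKV (fun=> 1) pI); rewrite inE.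
Qed.

Lemma vinvK p y : vcod p y -> p (virtual_inv p y) = y.
Proof.
case: (virtual_autP p) => _ _ [_ _ pS] _ _ py.
by apply: pinvK; rewrite inE; apply: pS.
Qed.

Lemma vinv_dom p y : vcod p y -> vdom p (virtual_inv p y).
Proof.
case: (virtual_autP p) => _ _ [_ _ pS] _ _ /pS[x px <-].
by rewrite vfunK.
Qed.

Lemma vfun_cont p x : vdom p x -> {for x, continuous p}.
Proof.
case: (virtual_autP p) => -[oU _ _] _ _ _ [+ _] px.
by rewrite continuous_open_subspace// => /(_ x); apply; rewrite inE.
Qed.

Lemma vinv_cont p x : vcod p x -> {for x, continuous (virtual_inv p)}.
Proof.
case: (virtual_autP p) => _ [oV _ _] _ _ [_ +] px.
by rewrite continuous_open_subspace// => /(_ x); apply; rewrite inE.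
Qed.

Lemma vfun1 p : p 1 = 1.
Proof.
have [_ p1 _] := vdomP p.
by apply: (mulgI (p 1)); rewrite -vfunM// !mulg1.
Qed.

Lemma vfunV p x : vdom p x -> p x^-1 = (p x)^-1.
Proof.
move=> px; apply: (mulgI (p x)); rewrite -vfunM ?mulgV ?vfun1//.
exact: open_subgroupV (vdomP p) px.
Qed.

Lemma is_virtual_autI U V (phi psi : G -> G) :
  open_subgroup U -> open_subgroup V ->
  (forall x, U x -> V (phi x)) -> (forall y, V y -> U (psi y)) ->
  (forall x, U x -> psi (phi x) = x) -> (forall y, V y -> phi (psi y) = y) ->
  (forall x y, U x -> U y -> phi (x * y) = phi x * phi y) ->
  (forall x, U x -> {for x, continuous phi}) ->
  (forall x, V x -> {for x, continuous psi}) ->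
  is_virtual_aut U V phi.
Proof.
move=> sU sV UV VU pK sK pM cp cs.
have pI : {in U &, injective phi}.
  by move=> x y; rewrite !inE => Ux Uy e; rewrite -(pK x)// e pK.
split=> //.
  by split=> // y Vy; exists (psi y); [exact: VU | exact: sK].
have [oU _ _] := sU; have [oV _ _] := sV.
split; first by rewrite continuous_open_subspace// => x; rewrite inE; apply: cp.
apply: (@subspace_eq_continuous _ V _ psi).
  move=> y; rewrite inE => Vy; rewrite /from_subspace/=.
  by rewrite -[in RHS](sK _ Vy) (pinvKV (fun=> 1) pI)// inE; apply: VU.
by rewrite continuous_open_subspace// => x; rewrite inE; apply: cs.
Qed.

Lemma vpreim_open_subgroup p W :
  open_subgroup W -> open_subgroup (vdom p `&` p @^-1` W).
Proof.
move=> sW; have [oW W1 Wd] := sW; have [oU U1 Ud] := vdomP p; split.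
- rewrite openE => x [px Wx]; apply: filterI; first exact: open_nbhs_nbhs.
  by apply: (vfun_cont px); apply: open_nbhs_nbhs.
- by split=> //=; rewrite vfun1.
- move=> x y [px Wx] [py Wy]; split; first exact: Ud.
  rewrite /= vfunM// ?vfunV//; first exact: Wd.
  exact: open_subgroupV (vdomP p) py.
Qed.

Lemma virtual_inv_subproof p : is_virtual_aut (vcod p) (vdom p) (virtual_inv p).
Proof.
apply: (@is_virtual_autI _ _ _ p); [exact: vcodP|exact: vdomP|exact: vinv_dom
  |exact: vfun_cod|exact: vinvK|exact: vfunK| |exact: vinv_cont|exact: vfun_cont].
move=> x y px py; rewrite -{1}(vinvK px) -{1}(vinvK py) -vfunM ?vfunK//;
  try exact: vinv_dom.
by apply: open_subgroupM; [exact: vdomP|exact: vinv_dom|exact: vinv_dom].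
Qed.

Definition virtual_aut_inv p := VirtualAut (virtual_inv_subproof p).

(* Composition [p \o q], defined on the largest possible open subgroup. *)
Definition vcomp_dom p q := vdom q `&` q @^-1` vdom p.
Definition vcomp_cod p q := vcod p `&` virtual_inv p @^-1` vcod q.

Lemma virtual_comp_subproof p q :
  is_virtual_aut (vcomp_dom p q) (vcomp_cod p q) (p \o q).
Proof.
apply: (@is_virtual_autI _ _ _ (virtual_inv q \o virtual_inv p)).
- exact: vpreim_open_subgroup (vdomP p).
- exact: (vpreim_open_subgroup (virtual_aut_inv p) (vcodP q)).
- move=> x [qx px]; split=> /=; first exact: vfun_cod.
  by rewrite vfunK//; exact: vfun_cod.
- move=> y [py qy]; split=> /=; first exact: vinv_dom.
  by rewrite vinvK//; exact: vinv_dom.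
- by move=> x [qx px] /=; rewrite !vfunK.
- by move=> y [py qy] /=; rewrite !vinvK.
- by move=> x y [qx px] [qy py] /=; rewrite !vfunM.
- by move=> x [qx px]; apply: continuous_comp; exact: vfun_cont.
- by move=> x [qx px]; apply: continuous_comp; exact: vinv_cont.
Qed.

Definition virtual_aut_comp p q := VirtualAut (virtual_comp_subproof p q).

(* The inner automorphism x |-> g x g^-1 (MathComp's [x ^ g] is g^-1 x g). *)
Definition conj_fun g : G -> G := fun x => g * x * g^-1.

Lemma conj_fun_continuous g : continuous (conj_fun g).
Proof.
move=> x; apply: (@continuous_comp _ _ _ (fun x => (g * x, g^-1))
  (fun z : G * G => z.1 * z.2)); last exact: mulg_continuous.
apply: cvg_pair; last exact: cvg_cst.
apply: (@continuous_comp _ _ _ (fun x => (g, x))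
  (fun z : G * G => z.1 * z.2)); last exact: mulg_continuous.
by apply: cvg_pair; [exact: cvg_cst | exact: cvg_id].
Qed.

Lemma conj_funK g : cancel (conj_fun g) (conj_fun g^-1).
Proof. by move=> x; rewrite /conj_fun invgK !mulgA mulVg mul1g mulgVK. Qed.

Lemma virtual_conj_subproof g : is_virtual_aut setT setT (conj_fun g).
Proof.
apply: (@is_virtual_autI _ _ _ (conj_fun g^-1)) => //; try exact: open_subgroupT.
- by move=> x _; exact: conj_funK.
- by move=> x _; have := conj_funK g^-1 x; rewrite invgK.
- by move=> x y _ _; rewrite /conj_fun !mulgA mulgVK.
- by move=> x _; exact: conj_fun_continuous.
- by move=> x _; exact: conj_fun_continuous.
Qed.

Definition virtual_conj g := VirtualAut (virtual_conj_subproof g).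

Definition virtual_eq p q : Prop :=
  exists2 W, open_subgroup W /\ W `<=` vdom p `&` vdom q &
             forall x, W x -> p x = q x.

Lemma virtual_eq_refl p : virtual_eq p p.
Proof. by exists (vdom p) => //; split; [exact: vdomP|]. Qed.

Lemma virtual_eq_sym p q : virtual_eq p q -> virtual_eq q p.
Proof. by case=> W [sW Ws] e; exists W; [rewrite setIC|move=> x /e]. Qed.

Lemma virtual_eq_trans q p r :
  virtual_eq p q -> virtual_eq q r -> virtual_eq p r.
Proof.
case=> W [sW Ws] e [W' [sW' Ws'] e']; exists (W `&` W').
  split; first exact: open_subgroupI.
  by move=> x [/Ws[? ?] /Ws'[? ?]].
by move=> x [Wx W'x]; rewrite e// e'.
Qed.

(* It is enough to agree on some open subgroup, regardless of the domains. *)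
Lemma virtual_eqI W p q :
  open_subgroup W -> (forall x, W x -> vdom p x -> vdom q x -> p x = q x) ->
  virtual_eq p q.
Proof.
move=> sW e; exists (W `&` (vdom p `&` vdom q)).
  split; last by move=> x [].
  by apply: open_subgroupI => //; apply: open_subgroupI; exact: vdomP.
by move=> x [Wx [px qx]]; exact: e.
Qed.

Definition virtual_eqb p q : bool := `[< virtual_eq p q >].

Lemma virtual_eqb_refl : reflexive virtual_eqb.
Proof. by move=> p; apply/asboolP/virtual_eq_refl. Qed.
Lemma virtual_eqb_sym : symmetric virtual_eqb.
Proof. by move=> p q; apply/asboolP/asboolP => /virtual_eq_sym. Qed.
Lemma virtual_eqb_trans : transitive virtual_eqb.
Proof.
by move=> q p r /asboolP pq /asboolP qr; apply/asboolP/(virtual_eq_trans pq).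
Qed.

Canonical virtual_equiv :=
  EquivRel virtual_eqb virtual_eqb_refl virtual_eqb_sym virtual_eqb_trans.

End VirtualAut.

Definition comm (G : topGroupType) : Type := {eq_quot @virtual_equiv G}%qT.
HB.instance Definition _ (G : topGroupType) := Choice.on (comm G).
HB.instance Definition _ (G : topGroupType) := EqQuotient.on (comm G).

Section Commensurator.
Local Open Scope group_scope.
Local Open Scope quotient_scope.
Variable G : topGroupType.
Implicit Types (U V W : set G) (g x : G) (p q r : virtual_aut G).
Implicit Types (b c : comm G).

Definition comm_class p : comm G := \pi_(comm G) p.

Lemma comm_classP p q : comm_class p = comm_class q <-> virtual_eq p q.
Proof.
split=> [/eqmodP/asboolP//|pq].
by apply/eqmodP/asboolP.
Qed.

Lemma comm_ind (P : comm G -> Prop) :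
  (forall p, P (comm_class p)) -> forall c, P c.
Proof. by move=> Pp c; rewrite -[c]reprK; exact: Pp. Qed.

Definition comm_one : comm G := comm_class (virtual_conj 1).
Definition comm_mul b c : comm G :=
  comm_class (virtual_aut_comp (repr b) (repr c)).
Definition comm_inv c : comm G := comm_class (virtual_aut_inv (repr c)).

Lemma repr_comm p : virtual_eq (repr (comm_class p)) p.
Proof. by apply/comm_classP; rewrite {1}/comm_class reprK. Qed.

Lemma comm_mulE p q :
  comm_mul (comm_class p) (comm_class q) = comm_class (virtual_aut_comp p q).
Proof.
apply/comm_classP.
have [W [sW Ws] eW] := repr_comm p; have [X [sX Xs] eX] := repr_comm q.
apply: (@virtual_eqI _ (X `&` (vdom q `&` q @^-1` W))).
  by apply: open_subgroupI => //; exact: vpreim_open_subgroup.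
by move=> x [Xx [qx Wx]] _ _ /=; rewrite eX// eW.
Qed.

Lemma comm_invE p : comm_inv (comm_class p) = comm_class (virtual_aut_inv p).
Proof.
apply/comm_classP; have [W [sW Ws] eW] := repr_comm p.
apply: (@virtual_eqI _ (vcod p `&` virtual_inv p @^-1` W)).
  exact: (vpreim_open_subgroup (virtual_aut_inv p)).
move=> y [py Wy] _ _ /=.
have [ry _] := Ws _ Wy.
by rewrite -{1}(vinvK py) -eW// vfunK.
Qed.

Lemma comm_mulA : associative comm_mul.
Proof.
elim/comm_ind=> p; elim/comm_ind=> q; elim/comm_ind=> r.
rewrite !comm_mulE; apply/comm_classP.
by apply: (virtual_eqI (@open_subgroupT G)).
Qed.

Lemma conj_fun1 x : conj_fun 1 x = x.
Proof. by rewrite /conj_fun invg1 mulg1 mul1g. Qed.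

Lemma comm_mul1 : left_id comm_one comm_mul.
Proof.
elim/comm_ind=> p; rewrite comm_mulE; apply/comm_classP.
by apply: (virtual_eqI (@open_subgroupT G)) => x _ _ _ /=; rewrite conj_fun1.
Qed.

Lemma comm_mulr1 : right_id comm_one comm_mul.
Proof.
elim/comm_ind=> p; rewrite comm_mulE; apply/comm_classP.
by apply: (virtual_eqI (@open_subgroupT G)) => x _ _ _ /=; rewrite conj_fun1.
Qed.

Lemma comm_mulV : left_inverse comm_one comm_inv comm_mul.
Proof.
elim/comm_ind=> p; rewrite comm_invE comm_mulE; apply/comm_classP.
apply: (virtual_eqI (vdomP p)) => x px _ _ /=.
by rewrite conj_fun1 vfunK.
Qed.

Lemma comm_mulrV : right_inverse comm_one comm_inv comm_mul.
Proof.
elim/comm_ind=> p; rewrite comm_invE comm_mulE; apply/comm_classP.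
apply: (virtual_eqI (vcodP p)) => x px _ _ /=.
by rewrite conj_fun1 vinvK.
Qed.

HB.instance Definition _ := isGroup.Build (comm G)
  comm_mulA comm_mul1 comm_mulr1 comm_mulV comm_mulrV.

(* Since conjugations by g on U and on G coincide on U, iota_U is the
   restriction to U of iota_G. *)
Definition comm_iota g : comm G := comm_class (virtual_conj g).

Lemma comm_iotaM g h : comm_iota (g * h) = comm_iota g * comm_iota h.
Proof.
rewrite [RHS]comm_mulE; apply/comm_classP.
apply: (virtual_eqI (@open_subgroupT G)) => x _ _ _ /=.
by rewrite /conj_fun invgM !mulgA.
Qed.

Lemma comm_iota1 : comm_iota 1 = 1. Proof. by []. Qed.

Lemma comm_iotaV g : comm_iota g^-1 = (comm_iota g)^-1.
Proof.
by apply: (mulgI (comm_iota g)); rewrite -comm_iotaM !mulgV comm_iota1.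
Qed.

Lemma comm_iotaJ p g :
  vdom p g -> comm_class p * comm_iota g = comm_iota (p g) * comm_class p.
Proof.
move=> pg; rewrite [LHS]comm_mulE [RHS]comm_mulE; apply/comm_classP.
apply: (virtual_eqI (vdomP p)) => x px _ _ /=.
rewrite /conj_fun !vfunM ?vfunV//.
- exact: open_subgroupM (vdomP p) pg px.
- exact: open_subgroupV (vdomP p) pg.
Qed.

(* Strong topology: the neighborhoods of c are the sets containing a left
   translate c iota_U(U); the remaining axioms of a group topology are
   established below. *)
Definition comm_nbhs c : set_system (comm G) :=
  [set W | exists2 U : set G,
     open_subgroup U & forall u, U u -> W (c * comm_iota u)].

HB.instance Definition _ := hasNbhs.Build (comm G) comm_nbhs.

Lemma comm_nbhs_filter c : ProperFilter (nbhs c).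
Proof.
split.
- by case=> U [_ U1 _] /(_ _ U1).
- split.
  + by exists setT => //; exact: open_subgroupT.
  + move=> A B [U sU UA] [V sV VB]; exists (U `&` V); first exact: open_subgroupI.
    by move=> u [Uu Vu]; split; [exact: UA|exact: VB].
  + by move=> A B AB [U sU UA]; exists U => // u Uu; exact/AB/UA.
Qed.

Lemma comm_nbhs_singleton c (A : set (comm G)) : nbhs c A -> A c.
Proof. by case=> U [_ U1 _] /(_ _ U1); rewrite comm_iota1 mulg1. Qed.

Lemma comm_nbhs_nbhs c (A : set (comm G)) : nbhs c A -> nbhs c (nbhs^~ A).
Proof.
case=> U sU UA; exists U => // u Uu; exists U => // v Uv.
by rewrite -mulgA -comm_iotaM; apply: UA; exact: open_subgroupM.
Qed.

HB.instance Definition _ := Nbhs_isNbhsTopological.Build (comm G)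
  comm_nbhs_filter comm_nbhs_singleton comm_nbhs_nbhs.

Lemma comm_mul_continuous :
  continuous (fun z : comm G * comm G => z.1 * z.2).
Proof.
case=> b; elim/comm_ind=> q A /= [U sU UA].
exists ([set b * comm_iota u | u in vcod q `&` virtual_inv q @^-1` U],
        [set comm_class q * comm_iota u | u in U]).
  split=> /=.
    exists (vcod q `&` virtual_inv q @^-1` U).
      exact: (vpreim_open_subgroup (virtual_aut_inv q)).
    by move=> u Uu; exists u.
  by exists U => // u Uu; exists u.
case=> _ _ [/= [u [qu Uu] <-] [v Uv <-]] /=.
rewrite mulgA -[b * _ * _]mulgA -{1}(vinvK qu) -comm_iotaJ; last exact: vinv_dom.
by rewrite -!mulgA -comm_iotaM mulgA; apply: UA; exact: open_subgroupM.
Qed.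

Lemma comm_inv_continuous : continuous (fun c : comm G => c^-1).
Proof.
elim/comm_ind=> p A /= [U sU UA].
exists (vdom p `&` p @^-1` U); first exact: vpreim_open_subgroup.
move=> u [pu Uu] /=; rewrite comm_iotaJ// invgM -comm_iotaV.
by apply: UA; exact: open_subgroupV.
Qed.

HB.instance Definition _ := Group_isTopGroup.Build (comm G)
  comm_mul_continuous comm_inv_continuous.

Definition hyperrigid : Prop := topgroup_iso comm_iota.

End Commensurator.

Section Fields.
Local Open Scope ring_scope.

Definition separable_over (E K : fieldType) (i : {rmorphism E -> K}) (x : K) :=
  exists p : {poly E},
    [/\ irreducible_poly p, separable_poly p & root (map_poly i p) x].

Definition separably_closed (K : fieldType) :=
  forall p : {poly K}, separable_poly p -> (1 < size p)%N -> exists x, root p x.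

Definition separable_closure (E K : fieldType) (i : {rmorphism E -> K}) :=
  (forall x, separable_over i x) /\ separably_closed K.

Definition field_iso (K1 K2 : fieldType) (f : K1 -> K2) :=
  [/\ zmod_morphism f, monoid_morphism f & bijective f].

(* Inverse of a bijection [f]; the default value 0 is irrelevant. *)
Definition inverse (K1 K2 : fieldType) (f : K1 -> K2) : K2 -> K1 :=
  'pinv_(fun=> 0) setT f.

Lemma field_isoK (K1 K2 : fieldType) (f : K1 -> K2) :
  field_iso f -> cancel f (inverse f).
Proof.
case=> _ _ /bij_inj fI x; apply: pinvKV; last by rewrite inE.
by move=> y z _ _; exact: fI.
Qed.

Lemma field_isoVK (K1 K2 : fieldType) (f : K1 -> K2) :
  field_iso f -> cancel (inverse f) f.
Proof.
case=> _ _ [g _ gK] y; apply: pinvK; rewrite inE.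
by exists (g y).
Qed.

Lemma field_iso_inverse (K1 K2 : fieldType) (f : K1 -> K2) :
  field_iso f -> field_iso (inverse f).
Proof.
move=> fi; have fK := field_isoK fi; have fVK := field_isoVK fi.
have [fB [f1 fM] _] := fi; split.
- by move=> x y; apply: (can_inj fK); rewrite fVK fB !fVK.
- split; first by rewrite -f1 fK.
  by move=> x y; apply: (can_inj fK); rewrite fVK fM !fVK.
- by exists f.
Qed.

Lemma field_iso_comp (K1 K2 K3 : fieldType) (g : K2 -> K3) (f : K1 -> K2) :
  field_iso g -> field_iso f -> field_iso (g \o f).
Proof.
move=> [gB [g1 gM] gb] [fB [f1 fM] fb]; split.
- by move=> x y /=; rewrite fB gB.
- by split=> [|x y] /=; rewrite ?f1 ?g1// fM gM.
- exact: bij_comp.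
Qed.

Lemma field_iso_id (K : fieldType) : field_iso (@idfun K).
Proof. by split=> //; exists idfun. Qed.

End Fields.

Section GaloisGroup.
Local Open Scope ring_scope.
Variables (E K : fieldType) (i : {rmorphism E -> K}).

Definition is_gal (f : K -> K) : Prop :=
  field_iso f /\ forall a, f (i a) = i a.

Record gal := Gal { gal_fun :> K -> K; _ : `[< is_gal gal_fun >] }.

HB.instance Definition _ := [isSub for gal_fun].
HB.instance Definition _ := [Choice of gal by <:].

Lemma galP (g : gal) : is_gal g.
Proof. exact/asboolP/(valP g). Qed.

Lemma gal_eqP (g h : gal) : g =1 h -> g = h.
Proof. by move=> gh; apply: val_inj; apply/funext. Qed.

Lemma gal_one_subproof : `[< is_gal idfun >].
Proof. by apply/asboolP; split=> //; exact: field_iso_id. Qed.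

Lemma gal_mul_subproof (g h : gal) : `[< is_gal (g \o h) >].
Proof.
apply/asboolP; have [gi gf] := galP g; have [hi hf] := galP h.
by split=> [|a /=]; [exact: field_iso_comp|rewrite hf gf].
Qed.

Lemma gal_inv_subproof (g : gal) : `[< is_gal (inverse g) >].
Proof.
apply/asboolP; have [gi gf] := galP g; split=> [|a].
  exact: field_iso_inverse.
by rewrite -{1}gf field_isoK.
Qed.

Definition gal_one := Gal gal_one_subproof.
Definition gal_mul g h := Gal (gal_mul_subproof g h).
Definition gal_inv g := Gal (gal_inv_subproof g).

Lemma gal_mulA : associative gal_mul.
Proof. by move=> f g h; exact: gal_eqP. Qed.
Lemma gal_mul1 : left_id gal_one gal_mul.
Proof. by move=> f; exact: gal_eqP. Qed.
Lemma gal_mulr1 : right_id gal_one gal_mul.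
Proof. by move=> f; exact: gal_eqP. Qed.
Lemma gal_mulV : left_inverse gal_one gal_inv gal_mul.
Proof. by move=> f; apply: gal_eqP => x /=; apply: field_isoK; case: (galP f). Qed.
Lemma gal_mulrV : right_inverse gal_one gal_inv gal_mul.
Proof. by move=> f; apply: gal_eqP => x /=; apply: field_isoVK; case: (galP f). Qed.

HB.instance Definition _ := isGroup.Build gal
  gal_mulA gal_mul1 gal_mulr1 gal_mulV gal_mulrV.

(* Krull topology: the automorphisms agreeing with g on a finite set s form the
   coset g Gal(K / E(s)), and the E(s) are the finitely generated
   subextensions of K / E. *)
Definition gal_nbhs (g : gal) : set_system gal :=
  [set W | exists s : seq K, forall h : gal, {in s, h =1 g} -> W h].

HB.instance Definition _ := hasNbhs.Build gal gal_nbhs.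

Lemma gal_nbhs_filter (g : gal) : ProperFilter (nbhs g).
Proof.
split.
- by case=> s /(_ g); apply.
- split.
  + by exists [::].
  + move=> A B [s sA] [t tB]; exists (s ++ t) => h hg.
    by split; [apply: sA|apply: tB] => x xs; apply: hg; rewrite mem_cat xs ?orbT.
  + by move=> A B AB [s sA]; exists s => h /sA /AB.
Qed.

Lemma gal_nbhs_singleton (g : gal) (A : set gal) : nbhs g A -> A g.
Proof. by case=> s; apply. Qed.

Lemma gal_nbhs_nbhs (g : gal) (A : set gal) : nbhs g A -> nbhs g (nbhs^~ A).
Proof.
case=> s sA; exists s => h hg; exists s => k kh.
by apply: sA => x xs; rewrite kh// hg.
Qed.

HB.instance Definition _ := Nbhs_isNbhsTopological.Build gal
  gal_nbhs_filter gal_nbhs_singleton gal_nbhs_nbhs.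

Lemma gal_mul_continuous : continuous (fun z : gal * gal => (z.1 * z.2)%g).
Proof.
case=> g h A /= [s sA].
exists ([set k : gal | {in map h s, k =1 g}], [set k : gal | {in s, k =1 h}]).
  by split; [exists (map h s)|exists s].
case=> k l /= [kg lh]; apply: sA => x xs /=.
by rewrite lh// kg// map_f.
Qed.

Lemma gal_inv_continuous : continuous (fun g : gal => (g^-1)%g).
Proof.
move=> g A /= [s sA]; exists (map (inverse g) s) => h hg.
have [gi _] := galP g; have [hi _] := galP h.
apply: sA => x xs /=; apply: (can_inj (field_isoK hi)).
by rewrite field_isoVK// hg ?map_f// field_isoVK.
Qed.

HB.instance Definition _ := Group_isTopGroup.Build gal
  gal_mul_continuous gal_inv_continuous.

End GaloisGroup.

Definition hyperrigid_field (F Fsep : fieldType) (i : {rmorphism F -> Fsep}) :=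
  hyperrigid (gal i).

Section IsoOver.
Local Open Scope ring_scope.
Variables (F E1 E2 K1 K2 : fieldType).
Variables (j1 : {rmorphism F -> E1}) (j2 : {rmorphism F -> E2}).
Variables (i1 : {rmorphism E1 -> K1}) (i2 : {rmorphism E2 -> K2}).

(* [Iso_F (K1 / E1, K2 / E2)]; E1, E2 and F are identified with their images
   under i1, i2 and the i \o j. *)
Definition is_iso_over (f : K1 -> K2) : Prop :=
  [/\ field_iso f, f @` range i1 = range i2 &
      forall a, f (i1 (j1 a)) = i2 (j2 a)].

Record iso_over := IsoOver { iso_fun :> K1 -> K2; _ : `[< is_iso_over iso_fun >] }.

HB.instance Definition _ := [isSub for iso_fun].
HB.instance Definition _ := [Choice of iso_over by <:].

Lemma iso_overP (f : iso_over) : is_iso_over f.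
Proof. exact/asboolP/(valP f). Qed.

Lemma iso_push_subproof (f : iso_over) (g : gal i1) :
  `[< is_gal i2 (f \o g \o inverse f) >].
Proof.
have [fi fE fF] := iso_overP f; have [gi gE] := galP g.
apply/asboolP; split=> [|b].
  apply: field_iso_comp; last exact: field_iso_inverse.
  exact: field_iso_comp.
have [_ [a _ <-] <- /=] : (f @` range i1) (i2 b) by rewrite fE; exists b.
by rewrite field_isoK// gE.
Qed.

(* alpha_* (g) = alpha g alpha^-1 *)
Definition iso_push (f : iso_over) (g : gal i1) : gal i2 :=
  Gal (iso_push_subproof f g).

End IsoOver.

(* A [fieldExtType F] is a finite extension of F, embedded by [in_alg]. *)
Definition neukirch_uchida (F : fieldType) : Prop :=
  forall (E1 E2 : fieldExtType F),
    separable 1 {:E1} -> separable 1 {:E2} ->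
  forall (K1 K2 : fieldType)
    (i1 : {rmorphism E1 -> K1}) (i2 : {rmorphism E2 -> K2}),
    separable_closure i1 -> separable_closure i2 ->
  forall sigma : gal i1 -> gal i2, topgroup_iso sigma ->
    exists! alpha : iso_over (in_alg E1) (in_alg E2) i1 i2,
      sigma = iso_push alpha.

(* Main.v *)
(* By Galois theory every open subgroup of G_F is Gal(Fsep / E) for a finite
   separable E / F, so a virtual automorphism of G_F is the same thing as an
   isomorphism Gal(Fsep / E1) -> Gal(Fsep / E2), and an F-automorphism g of Fsep
   inducing it is the same thing as an element of G_F conjugating by which agrees
   with it on Gal(Fsep / E1).  The class of a virtual automorphism phi in the
   commensurator only sees a smaller open subgroup; but phi iota(u) =
   iota(phi u) phi in the commensurator for u in the domain of phi, so if phi is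
   equivalent to conjugation by g and iota is injective, then g u = phi(u) g on
   the whole domain.

   The Galois theory used (uniqueness of separable closures, and E being the
   fixed field of Gal(Esep / E)) comes from Zorn's lemma applied to isomorphisms
   between subfields of K1 and K2, encoded as their graphs in K1 * K2. *)
From HB Require Import structures.
From mathcomp Require Import all_boot all_algebra all_field.
From mathcomp Require Import boolp classical_sets functions filter topology.
Require Import Defs.

Set Implicit Arguments.
Unset Strict Implicit.
Unset Printing Implicit Defensive.

Import GRing.Theory.
Local Open Scope classical_set_scope.
Local Open Scope ring_scope.

(** * Irreducible and separable polynomials *)

Section SeparablePolynomials.
Implicit Types D E K : fieldType.

Lemma irredp_dvd_root E K (i : {rmorphism E -> K}) (x : K) (p q : {poly E}) :
  irreducible_poly q -> root (map_poly i q) x -> root (map_poly i p) x ->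
  q %| p.
Proof.
move=> [_ irr_q] qx px; have dq := dvdp_gcdl q p.
rewrite -(eqp_dvdl p (irr_q _ _ dq)) ?dvdp_gcdr//.
have : root (map_poly i (gcdp q p)) x by rewrite gcdp_map root_gcd qx px.
apply: contraTneq => /eqP/size_poly1P[c c0 ->].
by rewrite map_polyC rootC fmorph_eq0.
Qed.

(** Among the nonzero polynomials vanishing at [x], one of minimal size is irreducible. *)
Lemma exists_irredp_root E K (i : {rmorphism E -> K}) (x : K) (p : {poly E}) :
  p != 0 -> root (map_poly i p) x ->
  exists q, [/\ irreducible_poly q, root (map_poly i q) x & q %| p].
Proof.
move=> p0 px.
pose P n := `[< exists q, [/\ q != 0, root (map_poly i q) x & size q = n] >].
have exP : exists n, P n by exists (size p); apply/asboolP; exists p.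
have [n /asboolP[q [q0 qx <-]] nmin] := ex_minnP exP.
have irr_q : irreducible_poly q.
  apply/(subfx_irreducibleP qx q0) => r rx r0.
  by apply: nmin; apply/asboolP; exists r.
by exists q; split=> //; exact: irredp_dvd_root irr_q qx px.
Qed.

(** Every irreducible factor of a separable polynomial is separable. This restores the
    irreducibility of the witness, which may be lost when the base field is enlarged. *)
Lemma separable_overP E K (i : {rmorphism E -> K}) (x : K) :
  (exists p, separable_poly p /\ root (map_poly i p) x) -> separable_over i x.
Proof.
case=> p [sp px]; have [q [iq qx qp]] :=
  exists_irredp_root (separable_poly_neq0 sp) px.
by exists q; split=> //; exact: dvdp_separable qp sp.
Qed.

Lemma separable_over_tower E D K (i : {rmorphism E -> K})
    (h : {rmorphism E -> D}) (j : {rmorphism D -> K}) (x : K) :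
  (forall a, j (h a) = i a) -> separable_over i x -> separable_over j x.
Proof.
move=> jh [p [_ sp px]]; apply: separable_overP; exists (map_poly h p).
by rewrite separable_map -map_poly_comp (eq_map_poly jh).
Qed.

Lemma separable_closure_tower E D K (i : {rmorphism E -> K})
    (h : {rmorphism E -> D}) (j : {rmorphism D -> K}) :
  (forall a, j (h a) = i a) -> separable_closure i -> separable_closure j.
Proof. by move=> jh [si sK]; split=> // x; exact: separable_over_tower jh _. Qed.

(** Roots are split off one at a time; [%=] absorbs the leading coefficient. *)
Lemma separably_closed_splits K (p : {poly K}) :
  separably_closed K -> separable_poly p ->
  exists rs : seq K, p %= \prod_(r <- rs) ('X - r%:P).
Proof.
move=> sK; have [n] := ubnP (size p); elim: n p => // n IH p pn sp.
have p0 := separable_poly_neq0 sp.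
have [p1|p1] := leqP (size p) 1.
  exists [::]; rewrite big_nil -size_poly_eq1 eqn_leq p1.
  by rewrite size_poly_gt0.
have [x /factor_theorem[q pE]] := sK p sp p1.
have q0 : q != 0 by apply: contraNneq p0 => q0; rewrite pE q0 mul0r.
have [rs qrs] : exists rs : seq K, q %= \prod_(r <- rs) ('X - r%:P).
  apply: IH; last by apply: dvdp_separable sp; rewrite pE dvdp_mulIl.
  by move: pn; rewrite pE size_Mmonic ?monicXsubC// size_XsubC addn2.
by exists (x :: rs); rewrite big_cons pE mulrC eqp_mul2l// polyXsubC_eq0.
Qed.

(** Degree at least 2 leaves a nonconstant quotient by ['X - x%:P]. A root of this quotient differs
    from [x] because a separable polynomial has no double root. *)
Lemma irreducible_distinct_root E K (i : {rmorphism E -> K}) (p : {poly E}) x :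
  separably_closed K -> separable_poly p -> (2 < size p)%N ->
  root (map_poly i p) x -> exists2 y, root (map_poly i p) y & y != x.
Proof.
move=> sK sp p2 /factor_theorem[q pE].
have sp' : separable_poly (q * ('X - x%:P)) by rewrite -pE separable_map.
have q0 : q != 0.
  by apply: contraTneq sp' => ->; rewrite mul0r; apply/negP => /separable_poly_neq0/eqP.
move: sp'; rewrite separable_root => /andP[sq qx].
have q1 : (1 < size q)%N.
  by move: p2; rewrite -(size_map_poly i) pE size_Mmonic ?monicXsubC// size_XsubC addn2.
have [y qy] := sK q sq q1; exists y; first by rewrite pE rootM qy.
by apply: contraNneq qx => <-.
Qed.

End SeparablePolynomials.

(** * Extension of isomorphisms between subfields *)

Section PartialIsomorphisms.
Variables K1 K2 : fieldType.
Implicit Types (R : set (K1 * K2)) (z w : K1 * K2).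

(* Graphs of isomorphisms between a subfield of K1 and a subfield of K2. *)
Definition partial_iso R : Prop :=
  [/\ R (1, 1), forall z w, R z -> R w -> R (z - w),
      forall z w, R z -> R w -> R (z * w),
      forall z, R z -> R (z.1^-1, z.2^-1) &
      forall z, R z -> (z.1 == 0) = (z.2 == 0)].

(** The difference of the two pairs has first coordinate 0, hence second coordinate 0. *)
Lemma partial_iso_functional R x y y' :
  partial_iso R -> R (x, y) -> R (x, y') -> y = y'.
Proof.
case=> _ RB _ _ R0 xy xy'; apply/eqP; rewrite -subr_eq0.
by have := R0 _ (RB _ _ xy xy') => /=; rewrite subrr eqxx => <-.
Qed.

Lemma partial_iso_maximal R0 : partial_iso R0 ->
  exists R, [/\ partial_iso R, R0 `<=` R &
    forall R', partial_iso R' -> R `<=` R' -> R' `<=` R].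
Proof.
move=> pR0; pose P R := R = set0 \/ partial_iso R /\ R0 `<=` R.
have chainP (F : set (set (K1 * K2))) : F `<=` P -> total_on F subset ->
    P (\bigcup_(R in F) R).
  move=> FP Ftot; have [->|/set0P[z0 [A0 FA0 A0z0]]] :=
    eqVneq (\bigcup_(R in F) R) set0; first by left.
  have good A z : F A -> A z -> partial_iso A /\ R0 `<=` A.
    by move=> /FP[->|//].
  have two z w : (\bigcup_(R in F) R) z -> (\bigcup_(R in F) R) w ->
      exists A, [/\ F A, A z, A w & partial_iso A].
    move=> [A FA Az] [B FB Bw]; have [pA _] := good A z FA Az.
    have [pB _] := good B w FB Bw.
    by have [AB|BA] := Ftot _ _ FA FB;
      [exists B; split=> //; exact: AB|exists A; split=> //; exact: BA].
  right; split; last first.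
    by move=> z R0z; exists A0 => //; have [_] := good A0 z0 FA0 A0z0; apply.
  split.
  - by exists A0 => //; have [[]] := good A0 z0 FA0 A0z0.
  - by move=> z w Fz Fw; have [A [FA Az Aw [_ AB _ _ _]]] := two z w Fz Fw;
      exists A => //; exact: AB.
  - by move=> z w Fz Fw; have [A [FA Az Aw [_ _ AM _ _]]] := two z w Fz Fw;
      exists A => //; exact: AM.
  - by move=> z Fz; have [A [FA Az _ [_ _ _ AV _]]] := two z z Fz Fz;
      exists A => //; exact: AV.
  - by move=> z Fz; have [A [FA Az _ [_ _ _ _]]] := two z z Fz Fz; apply.
have [R [[R_0|[pR R0R]] Rmax]] := Zorn_bigcup chainP; last first.
  exists R; split=> // R' pR' RR'; apply: contrapT => R'R.
  by apply: (Rmax R' (conj RR' R'R)); right; split=> // z /R0R/RR'.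
(* An empty maximal set would be properly contained in [R0]. *)
have RR0 : R `<` R0 by rewrite R_0; split=> // R0s; case: pR0 => /R0s.
by case: (Rmax R0 RR0); right; split.
Qed.

(* The graph R is itself a field, isomorphic to both subfields by projection:
   R is closed under division in the ring K1 * K2. *)
Section GraphField.
Variables (R : set (K1 * K2)) (pR : partial_iso R).

(** The proof is an argument of the predicate so that closure under division can be registered as an
    instance. *)
Definition graph_pred of partial_iso R : {pred K1 * K2} := fun z => `[< R z >].

Lemma graph_predP z : reflect (R z) (z \in graph_pred pR).
Proof. exact: asboolP. Qed.

(** Either both coordinates are nonzero and the pair is a unit, or both vanish and the pair is its
    own inverse by convention. *)
Lemma partial_iso_inv z : R z -> z^-1 = (z.1^-1, z.2^-1).
Proof.
case: pR => _ _ _ _ R0 /R0; case: z => x y /=.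
have [->|y0] := eqVneq y 0.
  by move=> /eqP->; rewrite invr_out ?invr0// unfold_in /= !unitr0.
move=> /negbT x0; have u : (x, y) \is a GRing.unit.
  by rewrite unfold_in /= !unitfE x0.
by apply: (mulrI u); rewrite mulrV//; congr (_, _); rewrite mulfV.
Qed.

Lemma graph_divring_closed : divring_closed (graph_pred pR).
Proof.
have [R1 RB RM RV _] := pR.
split=> [|z w /graph_predP Rz /graph_predP Rw|z w /graph_predP Rz /graph_predP Rw];
  apply/graph_predP => //; first exact: RB.
by apply: RM => //; rewrite partial_iso_inv//; exact: RV.
Qed.

HB.instance Definition _ :=
  GRing.isDivringClosed.Build (K1 * K2)%type (graph_pred pR) graph_divring_closed.

Record graph_field :=
  GraphField { graph_val :> K1 * K2; _ : graph_val \in graph_pred pR }.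

HB.instance Definition _ := [isSub for graph_val].
HB.instance Definition _ := [Choice of graph_field by <:].
HB.instance Definition _ := [SubChoice_isSubComUnitRing of graph_field by <:].

Lemma graph_field_unit (z : graph_field) : z != 0 -> z \is a GRing.unit.
Proof.
case: pR => _ _ _ RV R0 z0; have Rz : R (val z) by apply/graph_predP/valP.
apply/unitrP; have Sz : ((val z).1^-1, (val z).2^-1) \in graph_pred pR.
  by apply/graph_predP/RV.
have z2 : (val z).2 != 0.
  apply: contraNneq z0 => z2; apply/eqP/val_inj.
  have /eqP z1 : (val z).1 == 0 by rewrite (R0 _ Rz) z2.
  by rewrite [LHS]surjective_pairing z1 z2.
have z1 : (val z).1 != 0 by rewrite (R0 _ Rz).
by exists (GraphField Sz); split; apply: val_inj; congr (_, _);
  rewrite /= ?mulVf ?mulfV.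
Qed.

HB.instance Definition _ := GRing.ComUnitRing_isField.Build graph_field
  graph_field_unit.

Definition graph_fst (z : graph_field) : K1 := (val z).1.
Definition graph_snd (z : graph_field) : K2 := (val z).2.

Lemma graph_fst_zmod : zmod_morphism graph_fst. Proof. by []. Qed.
Lemma graph_fst_monoid : monoid_morphism graph_fst. Proof. by []. Qed.
Lemma graph_snd_zmod : zmod_morphism graph_snd. Proof. by []. Qed.
Lemma graph_snd_monoid : monoid_morphism graph_snd. Proof. by []. Qed.

HB.instance Definition _ :=
  GRing.isZmodMorphism.Build graph_field K1 graph_fst graph_fst_zmod.
HB.instance Definition _ :=
  GRing.isMonoidMorphism.Build graph_field K1 graph_fst graph_fst_monoid.
HB.instance Definition _ :=
  GRing.isZmodMorphism.Build graph_field K2 graph_snd graph_snd_zmod.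
HB.instance Definition _ :=
  GRing.isMonoidMorphism.Build graph_field K2 graph_snd graph_snd_monoid.

Section GraphBase.
Variables (E : fieldType) (i1 : {rmorphism E -> K1}) (i2 : {rmorphism E -> K2}).
Hypothesis iR : forall a, R (i1 a, i2 a).

Lemma graph_base_in a : (i1 a, i2 a) \in graph_pred pR.
Proof. exact/graph_predP. Qed.

Definition graph_base of (forall a, R (i1 a, i2 a)) := fun a => GraphField (graph_base_in a).

Lemma graph_base_zmod : zmod_morphism (graph_base iR).
Proof. by move=> a b; apply: val_inj; congr (_, _); rewrite /= rmorphB. Qed.
Lemma graph_base_monoid : monoid_morphism (graph_base iR).
Proof.
by split=> [|a b]; apply: val_inj; congr (_, _); rewrite /= ?rmorph1 ?rmorphM.
Qed.

HB.instance Definition _ :=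
  GRing.isZmodMorphism.Build E graph_field (graph_base iR) graph_base_zmod.
HB.instance Definition _ :=
  GRing.isMonoidMorphism.Build E graph_field (graph_base iR) graph_base_monoid.

Definition graph_base_morphism : {rmorphism E -> graph_field} := graph_base iR.

End GraphBase.
End GraphField.

Section AdjoinRoot.
Variables (D : fieldType) (j1 : {rmorphism D -> K1}) (j2 : {rmorphism D -> K2}).
Variables (p : {poly D}) (x : K1) (y : K2).
Hypotheses (irr_p : irreducible_poly p).
Hypotheses (px : root (map_poly j1 p) x) (py : root (map_poly j2 p) y).

(* For irreducible p, the graph of D(x) -> D(y), x |-> y. *)
Definition adjoin_graph : set (K1 * K2) :=
  [set z | exists q : {poly D}, z = ((map_poly j1 q).[x], (map_poly j2 q).[y])].

(** Both sides are equivalent to divisibility of [q] by [p]. Hence the correspondence of values at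
    [x] and [y] is well defined and injective. *)
Lemma adjoin_graph_root (q : {poly D}) :
  root (map_poly j1 q) x = root (map_poly j2 q) y.
Proof.
apply/idP/idP => [qx|qy].
  by have /dvdpP[r ->] := irredp_dvd_root irr_p px qx; rewrite rmorphM rootM py orbT.
by have /dvdpP[r ->] := irredp_dvd_root irr_p py qy; rewrite rmorphM rootM px orbT.
Qed.

Lemma adjoin_partial_iso : partial_iso adjoin_graph.
Proof.
split.
- by exists 1; rewrite !rmorph1 !hornerC.
- by move=> _ _ [q ->] [r ->]; exists (q - r); rewrite !rmorphB !hornerE.
- by move=> _ _ [q ->] [r ->]; exists (q * r); rewrite !rmorphM !hornerE.
- move=> _ [q ->] /=; have [qx|qx] := boolP (root (map_poly j1 q) x).
    exists 0; rewrite !rmorph0 !horner0 (eqP qx).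
    by move: qx; rewrite adjoin_graph_root => /eqP->; rewrite !invr0.
  (* A Bezout relation u q + v p = 1 gives u as the inverse of q at [x] and at [y]
     simultaneously. *)
  have : coprimep q p.
    have [_ irr] := irr_p; apply: contraR qx; rewrite /coprimep => d1.
    have dp := irr _ d1 (dvdp_gcdr q p).
    by move: px; rewrite -!dvdp_XsubCl => /dvdp_trans; apply;
      rewrite dvdp_map -(eqp_dvdl _ dp) dvdp_gcdl.
  case/Bezout_eq1_coprimepP => -[u v] /= uv; exists u.
  have inv (K : fieldType) (j : {rmorphism D -> K}) t : root (map_poly j p) t ->
      (map_poly j q).[t]^-1 = (map_poly j u).[t].
    move=> /rootP pt; apply: mulr1_eq.
    have := congr1 (fun r => (map_poly j r).[t]) uv.
    by rewrite rmorphD !rmorphM !hornerE pt mulr0 addr0 mulrC rmorph1 hornerC.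
  by congr (_, _); exact: inv.
- by move=> _ [q ->]; exact: adjoin_graph_root.
Qed.

Lemma adjoin_graph_gen : adjoin_graph (x, y).
Proof. by exists 'X; rewrite !map_polyX !hornerX. Qed.

Lemma adjoin_graph_base a : adjoin_graph (j1 a, j2 a).
Proof. by exists a%:P; rewrite !map_polyC !hornerC. Qed.

End AdjoinRoot.
End PartialIsomorphisms.

(** * Embeddings, uniqueness and fixed fields of separable closures *)

Section Extension.
Implicit Types E K : fieldType.

Lemma partial_iso_swap K1 K2 (R : set (K1 * K2)) :
  partial_iso R -> partial_iso [set z : K2 * K1 | R (z.2, z.1)].
Proof.
case=> R1 RB RM RV R0; split=> //=.
- by move=> z w Rz Rw; exact: RB Rz Rw.
- by move=> z w Rz Rw; exact: RM Rz Rw.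
- by move=> z Rz; exact: RV Rz.
- by move=> z /R0 /= ->.
Qed.

(** The irreducible polynomial of [x] over the graph field, mapped to [K2], has a root [y] there.
    Adjoining (x, y) extends [R], so by maximality the pair already lies in [R]. *)
Lemma maximal_partial_iso_total E K1 K2 (i1 : {rmorphism E -> K1})
    (i2 : {rmorphism E -> K2}) (R : set (K1 * K2)) (x : K1) :
  partial_iso R ->
  (forall R', partial_iso R' -> R `<=` R' -> R' `<=` R) ->
  (forall a, R (i1 a, i2 a)) -> separable_over i1 x -> separably_closed K2 ->
  exists y, R (x, y).
Proof.
move=> pR Rmax iR sx sK.
have [p [irr_p sp px]] : separable_over (graph_fst (pR := pR)) x.
  exact: (@separable_over_tower _ _ _ i1 (graph_base_morphism pR iR)) sx.
have [y py] : exists y, root (map_poly (graph_snd (pR := pR)) p) y.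
  apply: sK; first by rewrite separable_map.
  by rewrite size_map_poly; case: irr_p.
exists y; apply: Rmax (adjoin_partial_iso irr_p px py) _ _ (adjoin_graph_gen _ _ _ _).
move=> z Rz; have Sz : z \in graph_pred pR by apply/graph_predP.
have := adjoin_graph_base (graph_fst (pR := pR)) (graph_snd (pR := pR)) x y (GraphField Sz).
by rewrite /graph_fst /graph_snd /= -surjective_pairing.
Qed.

(** A maximal partial isomorphism above [R0] is total, hence the graph of a morphism. *)
Lemma embedding_extension E K1 K2 (i1 : {rmorphism E -> K1})
    (i2 : {rmorphism E -> K2}) (R0 : set (K1 * K2)) :
  partial_iso R0 -> (forall a, R0 (i1 a, i2 a)) ->
  (forall x, separable_over i1 x) -> separably_closed K2 ->
  exists f : K1 -> K2, [/\ zmod_morphism f, monoid_morphism f,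
    forall x y, R0 (x, y) -> f x = y &
    separable_closure i1 -> separable_closure i2 -> field_iso f].
Proof.
move=> pR0 iR0 s1 c2; have [R [pR R0R Rmax]] := partial_iso_maximal pR0.
have iR a : R (i1 a, i2 a) by exact: R0R.
have tot x := maximal_partial_iso_total pR Rmax iR (s1 x) c2.
have [f fR] := choice tot.
have fE x y : R (x, y) -> f x = y.
  by move=> xy; exact: partial_iso_functional pR (fR x) xy.
have [R1 RB RM RV Rz] := pR.
have fB : zmod_morphism f by move=> x y; exact/fE/(RB _ _ (fR x) (fR y)).
have fM : monoid_morphism f.
  by split=> [|x y]; [exact: fE|exact/fE/(RM _ _ (fR x) (fR y))].
exists f; split=> // [x y /R0R/fE//|[_ c1] [s2 _]]; split=> //.
(* Maximality is symmetric in the two coordinates, so the swapped relation is total as well and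
   provides the inverse of [f]. *)
have pS := partial_iso_swap pR.
have Smax S : partial_iso S -> [set z : K2 * K1 | R (z.2, z.1)] `<=` S ->
    S `<=` [set z : K2 * K1 | R (z.2, z.1)].
  move=> /partial_iso_swap pS' RS [y x] Sxy /=.
  by apply: (Rmax _ pS') => // -[x' y'] /= Rx; exact: RS.
have totS y := @maximal_partial_iso_total _ _ _ i2 i1 _ _ pS Smax iR (s2 y) c1.
have [g gR] := choice totS; have {}gR y : R (g y, y) := gR y.
exists g => [x|y]; last exact: fE.
apply: (@partial_iso_functional _ _ [set z : K2 * K1 | R (z.2, z.1)] (f x)) => //.
exact: gR.
Qed.

Lemma base_partial_iso E K1 K2 (i1 : {rmorphism E -> K1})
    (i2 : {rmorphism E -> K2}) :
  partial_iso [set z | exists a, z = (i1 a, i2 a)].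
Proof.
split.
- by exists 1; rewrite !rmorph1.
- by move=> _ _ [a ->] [b ->]; exists (a - b); rewrite !rmorphB.
- by move=> _ _ [a ->] [b ->]; exists (a * b); rewrite !rmorphM.
- by move=> _ [a ->]; exists a^-1; rewrite !fmorphV.
- by move=> _ [a ->] /=; rewrite !fmorph_eq0.
Qed.

Lemma separable_closure_unique E K1 K2 (i1 : {rmorphism E -> K1})
    (i2 : {rmorphism E -> K2}) :
  separable_closure i1 -> separable_closure i2 ->
  exists2 f : K1 -> K2, field_iso f & forall a, f (i1 a) = i2 a.
Proof.
move=> c1 c2; have [f [_ _ fE fI]] : exists f : K1 -> K2, [/\ zmod_morphism f,
    monoid_morphism f, forall x y, [set z | exists a, z = (i1 a, i2 a)] (x, y) ->
    f x = y & separable_closure i1 -> separable_closure i2 -> field_iso f].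
  apply: embedding_extension => [|a| |]; first exact: base_partial_iso.
  - by exists a.
  - by case: c1.
  - by case: c2.
by exists f => [|a]; [exact: fI|apply: fE; exists a].
Qed.

Lemma separable_embedding E K1 K2 (i1 : {rmorphism E -> K1})
    (i2 : {rmorphism E -> K2}) :
  (forall x, separable_over i1 x) -> separably_closed K2 ->
  exists f : {rmorphism K1 -> K2}, forall a, f (i1 a) = i2 a.
Proof.
move=> s1 c2; have [f [fB fM fE _]] := embedding_extension
  (base_partial_iso i1 i2) (fun a => ex_intro _ a erefl) s1 c2.
pose fBm := GRing.isZmodMorphism.Build _ _ f fB.
pose fMm := GRing.isMonoidMorphism.Build _ _ f fM.
pose f' : {rmorphism K1 -> K2} := HB.pack f fBm fMm.
by exists f' => a; apply: fE; exists a.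
Qed.

(** If the irreducible polynomial of [x] has degree at least 2, it has another root, and sending [x]
    to that root extends to an automorphism moving [x]. In degree 1, [x] is a quotient of
    coefficients. *)
Lemma gal_fixed E K (i : {rmorphism E -> K}) (x : K) :
  separable_closure i -> (forall g : gal i, g x = x) -> range i x.
Proof.
move=> ci fix_x; have [p [irr_p sp px]] := ci.1 x.
have [p2|p2] := ltnP 2 (size p).
  have [y py yx] := irreducible_distinct_root ci.2 sp p2 px.
  have [f [_ _ fE fI]] := embedding_extension (adjoin_partial_iso irr_p px py)
    (adjoin_graph_base _ _ _ _) ci.1 ci.2.
  have gf : `[< is_gal i f >].
    apply/asboolP; split; first exact: fI.
    by move=> a; apply: fE; exact: adjoin_graph_base.
  have fx := fix_x (Gal gf); rewrite /= in fx.
  by move: yx; rewrite -(fE _ _ (adjoin_graph_gen _ _ _ _)) fx eqxx.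
have {p2} p2 : size p = 2.
  by apply/eqP; rewrite eqn_leq p2; case: irr_p.
have p1 : p`_1 != 0.
  by have := irredp_neq0 irr_p; rewrite -lead_coef_eq0 lead_coefE p2.
exists (- p`_0 / p`_1) => //; move: px.
rewrite rootE horner_coef size_map_poly p2 !big_ord_recl big_ord0 /=.
rewrite !coef_map expr0 expr1 mulr1 addr0 => /eqP px.
rewrite fmorph_div rmorphN; apply: (canLR (mulfK _)); first by rewrite fmorph_eq0.
by apply/eqP; rewrite eq_sym -subr_eq0 opprK addrC mulrC px.
Qed.

End Extension.

(** * Open subgroups of the Galois group *)

Section GaloisAction.
Variables (F K : fieldType) (i : {rmorphism F -> K}).
Implicit Types g h : gal i.

Lemma gal_zmod_morphism g : zmod_morphism g. Proof. by case: (galP g) => -[]. Qed.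
Lemma gal_monoid_morphism g : monoid_morphism g.
Proof. by case: (galP g) => -[]. Qed.

HB.instance Definition _ g :=
  GRing.isZmodMorphism.Build K K (gal_fun g) (gal_zmod_morphism g).
HB.instance Definition _ g :=
  GRing.isMonoidMorphism.Build K K (gal_fun g) (gal_monoid_morphism g).

Lemma gal_base g a : g (i a) = i a. Proof. by case: (galP g). Qed.

Lemma galK g : cancel g (g^-1)%g.
Proof. by move=> x; rewrite -[LHS]/((g^-1 * g)%g x) mulVg. Qed.

Lemma galVK g : cancel (g^-1)%g g.
Proof. by move=> x; rewrite -[LHS]/((g * g^-1)%g x) mulgV. Qed.

Lemma gal_root g (p : {poly F}) x :
  root (map_poly i p) (g x) = root (map_poly i p) x.
Proof.
rewrite -[RHS](fmorph_root g) -map_poly_comp.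
by rewrite (eq_map_poly (_ : g \o i =1 i))// => a; exact: gal_base.
Qed.

End GaloisAction.

Section FiniteSubextensions.
Variables (F K : fieldType) (i : {rmorphism F -> K}).

(** F(t) is built by adjoining the elements of [t] successively; the last clause expresses that [t]
    generates it. *)
Lemma finite_subextension (t : seq K) : (forall x, separable_over i x) ->
  exists (E : fieldExtType F) (j : {rmorphism E -> K}),
    [/\ forall a, j (in_alg E a) = i a, forall x, x \in t -> range j x &
        forall h : gal i, {in t, h =1 id} -> forall a, h (j a) = j a].
Proof.
move=> si; elim: t => [|x t [E [j [jF jt jfix]]]].
  (* For empty [t], the extension is [F] over itself. *)
  have iF (a : F) : i (in_alg F^o a) = i a by congr (i _); exact: mulr1.
  by exists F^o, i; split=> // h _ a; have [_ ->] := galP h.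
have [p [irr_p _ px]] := separable_over_tower jF (si x).
have p0 := irredp_neq0 irr_p.
pose L : fieldExtType E := SubFieldExtType px irr_p.
pose inj : {rmorphism L -> K} := @subfx_inj _ _ j x p.
have injE a : inj a%:A = j a := subfx_inj_base px p0 a.
pose L0 : fieldExtType F := baseFieldType L.
exists L0, (inj : {rmorphism L0 -> K}); split=> [a|y|h hfix y].
- have -> : in_alg L0 a = (in_alg E a)%:A :> L by [].
  by rewrite [LHS]injE jF.
- rewrite inE => /predU1P[->|/jt[a _ <-]].
    by exists (@subfx_root _ _ j x p) => //; exact: subfx_inj_root.
  by exists (a%:A : L) => //; exact: injE.
- have ht : forall a, h (j a) = j a.
    by apply: jfix => a ta; apply: hfix; rewrite inE ta orbT.
  (* Elements of [L] are polynomials in [x] over [E], and [h] fixes both [x] and the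
     coefficients. *)
  have [q ->] := subfxE y; rewrite [inj _](subfx_inj_eval px p0).
  rewrite -horner_map -map_poly_comp /=.
  rewrite (eq_map_poly ht) hfix ?mem_head//.
Qed.

Variables (E : fieldExtType F).

Lemma separable_ext_of_closure (j : {rmorphism E -> K}) :
  (forall a, j (in_alg E a) = i a) -> (forall x, separable_over i x) ->
  separable 1 {:E}.
Proof.
move=> jF si; apply/separableP => y _.
have [p [_ sp py]] := si (j y).
have : separable_poly (map_poly (in_alg E) p) by rewrite separable_map.
apply: dvdp_separable; apply: minPoly_dvdp.
  by apply/polyOver1P; exists p.
by rewrite -(fmorph_root j) -map_poly_comp (eq_map_poly jF).
Qed.

Lemma separable_ext_separable_over :
  separable 1 {:E} -> forall y, separable_over (in_alg E) y.
Proof.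
move=> /separableP sE y; apply: separable_overP.
have /polyOver1P[p pE] := minPolyOver 1 y.
exists p; have := sE y (memvf y); rewrite /separable_element pE.
by rewrite separable_map -pE root_minPoly.
Qed.

Lemma separable_ext_primitive : separable 1 {:E} ->
  exists z : E, forall y, exists q : {poly F}, y = (map_poly (in_alg E) q).[z].
Proof.
move=> sE; exists (separable_generator 1 {:E}) => y.
have : y \in <<1; separable_generator 1 {:E}>>%VS.
  by rewrite -eq_adjoin_separable_generator ?memvf ?subvf.
by case/Fadjoin_polyP => p /polyOver1P[q ->] ->; exists q.
Qed.

End FiniteSubextensions.

(** For an embedding [j] of a field E this is Gal(K / E). An arbitrary type [T] also allows
    stabilizers of finite sequences, via [nth 0 s]. *)
Definition gal_fixer (F K : fieldType) (i : {rmorphism F -> K}) (T : Type)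
  (j : T -> K) : set (gal i) := [set h : gal i | forall a, h (j a) = j a].
Arguments gal_fixer {F K} i {T} j.

Section OpenSubgroups.
Variables (F K : fieldType) (i : {rmorphism F -> K}).
Implicit Types (g h : gal i) (U : set (gal i)).

Lemma gal_fixer_open_subgroup (T : Type) (j : T -> K) (s : seq K) :
  (forall h, {in s, h =1 id} -> gal_fixer i j h) ->
  open_subgroup (gal_fixer i j).
Proof.
move=> sj.
have jd g h : gal_fixer i j g -> gal_fixer i j h -> gal_fixer i j (g * h^-1)%g.
  move=> gj hj a; rewrite -[LHS]/(g ((h^-1)%g (j a))).
  by rewrite -{1}(hj a) galK.
split=> //; rewrite openE => g gj; exists s => h hg.
(* A subgroup containing a neighborhood of 1 is open: g^-1 h fixes [s], and h is recovered from it
   and g using only the closure property [jd]. *)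
have -> : h = (g * (h^-1 * g)^-1)%g by rewrite invgM invgK mulgA mulgV mul1g.
apply: (jd) => //; have -> : (h^-1 * g = 1 * (g^-1 * h)^-1)%g.
  by rewrite invgM invgK mul1g.
apply: (jd) => //; apply: sj => x xs.
by rewrite -[LHS]/((g^-1)%g (h x)) hg// galK.
Qed.

(** By linearity over [F], fixing a finite basis of [E] suffices. *)
Lemma finite_gal_fixer_open_subgroup (E : fieldExtType F)
    (j : {rmorphism E -> K}) :
  (forall a, j (in_alg E a) = i a) -> open_subgroup (gal_fixer i j).
Proof.
move=> jF; apply: (@gal_fixer_open_subgroup _ _ (map j (vbasis {:E}))) => h hs a.
have jZ c b : j (c *: b) = i c * j b by rewrite -jF -rmorphM mulr_algl.
rewrite (coord_vbasis (memvf a)) !rmorph_sum; apply: eq_bigr => k _ /=.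
rewrite jZ rmorphM /= gal_base hs// map_f// mem_nth// size_tuple.
exact: ltn_ord.
Qed.

Lemma open_subgroup_gal_nbhs U : open_subgroup U ->
  exists s : seq K, forall h, {in s, h =1 id} -> U h.
Proof.
by case=> oU U1 _; move: oU; rewrite openE => /(_ _ U1)[s sU]; exists s.
Qed.

(* U contains the stabilizer of a primitive element theta of some finite
   extension.  The polynomial q with roots U theta is fixed by U, and an
   automorphism h fixing q satisfies h theta = u theta for some u in U, so that
   u^-1 h, hence h, lies in U: E is generated by the coefficients of q. *)
Lemma open_subgroup_fixer U : separable_closure i -> open_subgroup U ->
  exists (E : fieldExtType F) (j : {rmorphism E -> K}),
    (forall a, j (in_alg E a) = i a) /\ U = gal_fixer i j.
Proof.
move=> ci sU; have [t tU] := open_subgroup_gal_nbhs sU.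
have [E0 [j0 [j0F j0t _]]] := finite_subextension t ci.1.
have [z zE] := separable_ext_primitive (separable_ext_of_closure j0F ci.1).
pose theta := j0 z.
have thetaU h : h theta = theta -> U h.
  move=> ht; apply: tU => x /j0t[y _ <-]; have [q ->] := zE y.
  have -> : j0 (map_poly (in_alg E0) q).[z] = (map_poly i q).[theta].
    by rewrite -horner_map -map_poly_comp (eq_map_poly j0F).
  by rewrite -horner_map -map_poly_comp (eq_map_poly (gal_base h)) /= ht.
have [p [_ sp pt]] := ci.1 theta.
have [rs prs] : exists rs : seq K, map_poly i p %= \prod_(r <- rs) ('X - r%:P).
  by apply: separably_closed_splits ci.2 _; rewrite separable_map.
(* The orbit of [theta] under [U] is finite, since it consists of roots of [p]. *)
pose orb := undup [seq r <- rs | `[< exists2 u, U u & u theta = r >]].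
have orbP r : r \in orb <-> exists2 u, U u & u theta = r.
  rewrite mem_undup mem_filter; split=> [/andP[/asboolP]//|].
  move=> [u Uu <-]; apply/andP; split; first by apply/asboolP; exists u.
  by rewrite -root_prod_XsubC -(eqp_root prs) gal_root.
pose q := \prod_(r <- orb) ('X - r%:P).
have Uq u : U u -> map_poly u q = q.
  (* [u] maps the finite orbit injectively into itself, hence permutes it. *)
  move=> Uu; have orb_perm : perm_eq (map u orb) orb.
    have uI : uniq (map u orb).
      by rewrite map_inj_uniq ?undup_uniq//; exact: can_inj (galK u).
    have uO : {subset map u orb <= orb}.
      move=> _ /mapP[r /orbP[v Uv <-] ->]; apply/orbP.
      by exists (u * v)%g => //; exact: open_subgroupM.
    apply: uniq_perm => //; first exact: undup_uniq.
    by have [] := uniq_min_size uI uO; rewrite ?size_map.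
  rewrite /q rmorph_prod -[RHS](perm_big _ orb_perm) big_map.
  by apply: eq_bigr => r _; rewrite rmorphB /= map_polyX map_polyC.
have [E [j [jF jq jfix]]] := finite_subextension q ci.1.
exists E, j; split=> //; apply/seteqP; split=> h.
  move=> Uh; apply: jfix => c /(nthP 0)[k _ <-].
  by rewrite -[in RHS](Uq _ Uh) coef_map.
move=> hj; have hq : map_poly h q = q.
  apply/polyP => k; rewrite coef_map.
  have [kq|kq] := ltnP k (size q); last first.
    by rewrite (nth_default 0 kq) -[RHS](rmorph0 h).
  by have [a _ <-] := jq _ (mem_nth 0 kq); exact: hj.
have : root q (h theta).
  rewrite -hq fmorph_root root_prod_XsubC; apply/orbP.
  by exists 1%g => //; case: sU.
rewrite root_prod_XsubC => /orbP[u Uu ut].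
have Uuh : U (u^-1 * h)%g.
  by apply: thetaU; rewrite -[LHS]/((u^-1)%g (h theta)) -ut galK.
have -> : h = (u * (u^-1 * h))%g by rewrite mulgA mulgV mul1g.
exact: open_subgroupM.
Qed.

End OpenSubgroups.

(** * Rigidity and transport of Galois groups *)

Section Rigidity.
Variables (F K : fieldType) (i : {rmorphism F -> K}).
Implicit Types (g h : gal i) (p : virtual_aut (gal i)).

Lemma comm_iota_continuous : continuous (@comm_iota (gal i)).
Proof.
move=> g A [U sU UA]; have [s sU'] := open_subgroup_gal_nbhs sU.
exists s => h hg; have -> : h = (g * (g^-1 * h))%g by rewrite mulgA mulgV mul1g.
rewrite /= comm_iotaM; apply/UA/sU' => x xs.
by rewrite -[LHS]/((g^-1)%g (h x)) hg// galK.
Qed.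

(** A bijective [comm_iota] is automatically a homeomorphism: the open subgroups, which define the
    strong topology, form a base at 1 of the Krull topology. *)
Lemma hyperrigid_galP : hyperrigid (gal i) <->
  injective (@comm_iota (gal i)) /\
  forall p, exists g, comm_class p = comm_iota g.
Proof.
split=> [[_ _ [f [iK fK] _]]|[iI iS]].
  by split=> [|p]; [exact: can_inj iK|exists (f (comm_class p)); rewrite fK].
have /choice[f fK] : forall c : comm (gal i), exists g, comm_iota g = c.
  by elim/comm_ind=> p; have [g] := iS p; exists g.
have iK : cancel (@comm_iota (gal i)) f by move=> g; apply: iI.
split; [exact: comm_iotaM|exact: comm_iota_continuous|exists f => //].
(* Beyond the end of [s], [nth] returns 0, which every automorphism fixes. *)
move=> c A [s sA]; exists (gal_fixer i (nth 0 s)).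
  apply: (gal_fixer_open_subgroup (s := s)) => h hs k.
  have [ks|ks] := ltnP k (size s); first by rewrite hs// mem_nth.
  by rewrite (nth_default 0 ks) -[RHS](rmorph0 h).
move=> u us /=; rewrite -(fK c) -comm_iotaM !iK.
apply: sA => x /(nthP 0)[k _ <-].
by rewrite -[LHS]/(f c (u (nth 0 s k))) us.
Qed.

End Rigidity.

(** * Transport of Galois groups along a field isomorphism *)

Section Transport.
Variables (F K E K' : fieldType).
Variables (i : {rmorphism F -> K}) (e : {rmorphism F -> E}).
Variables (i' : {rmorphism E -> K'}) (b : K' -> K).
Hypotheses (bI : field_iso b) (bF : forall a, b (i' (e a)) = i a).

Lemma gal_push_subproof (g : gal i') : `[< is_gal i (b \o g \o inverse b) >].
Proof.
have [gI _] := galP g; apply/asboolP; split=> [|a].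
  apply: field_iso_comp; last exact: field_iso_inverse.
  exact: field_iso_comp.
by rewrite /= -bF field_isoK// gal_base.
Qed.

Definition gal_push (g : gal i') : gal i := Gal (gal_push_subproof g).

(* Only meaningful for h fixing b (i' E), and 1 otherwise. *)
Definition gal_pull (h : gal i) : gal i' := insubd (gal_one i') (inverse b \o h \o b).

Local Notation U := (gal_fixer i (b \o i')).

Lemma gal_push_in g : U (gal_push g).
Proof. by move=> a /=; rewrite field_isoK// gal_base. Qed.

Lemma gal_pullE h x : U h -> gal_pull h x = inverse b (h (b x)).
Proof.
move=> Uh; rewrite -[gal_fun _]/(val (gal_pull h)) val_insubd.
suff -> : `[< is_gal i' (inverse b \o h \o b) >] by [].
have [hI _] := galP h; apply/asboolP; split=> [|a].
  apply: field_iso_comp => //; apply: field_iso_comp => //.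
  exact: field_iso_inverse.
by rewrite /= (Uh a) field_isoK.
Qed.

Lemma gal_pushK : cancel gal_push gal_pull.
Proof.
move=> g; apply: gal_eqP => x; rewrite gal_pullE; last exact: gal_push_in.
by rewrite /= !field_isoK.
Qed.

Lemma gal_pullK h : U h -> gal_push (gal_pull h) = h.
Proof. by move=> Uh; apply: gal_eqP => x; rewrite /= gal_pullE// !field_isoVK. Qed.

Lemma gal_pushM g g' : gal_push (g * g')%g = (gal_push g * gal_push g')%g.
Proof. by apply: gal_eqP => x /=; rewrite field_isoK. Qed.

Lemma gal_pullM h h' : U h -> U h' ->
  gal_pull (h * h')%g = (gal_pull h * gal_pull h')%g.
Proof.
by move=> /gal_pullK <- /gal_pullK <-; rewrite -gal_pushM !gal_pushK.
Qed.

Lemma gal_push_continuous : continuous gal_push.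
Proof.
move=> g A [s sA]; exists (map (inverse b) s) => g' gg'.
by apply: sA => x xs /=; rewrite gg'// map_f.
Qed.

(** Openness of [U] yields a finite set on which agreement with [h] keeps [h'] in [U], away from the
    default value of [gal_pull]. *)
Lemma gal_pull_continuous h : open U -> U h -> {for h, continuous gal_pull}.
Proof.
rewrite openE => oU Uh A [s sA]; have [t tU] := oU _ Uh.
exists (map b s ++ t) => h' hh'; have Uh' : U h'.
  by apply: tU => x xt; apply: hh'; rewrite mem_cat xt orbT.
by apply: sA => x xs; rewrite !gal_pullE// hh'// mem_cat map_f.
Qed.

End Transport.

(** * Neukirch-Uchida property and hyperrigidity *)

Lemma inverse_id (K : fieldType) (x : K) : inverse idfun x = x.
Proof. exact: (field_isoVK (field_iso_id K)). Qed.

Section NeukirchUchida.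
Variables (F Fsep : fieldType) (i : {rmorphism F -> Fsep}).
Hypothesis ci : separable_closure i.
Implicit Types (g h : gal i) (p : virtual_aut (gal i)).

(* If conjugation by g is trivial on Gal(Fsep / E), then g and the identity both
   induce the identity of Gal(Fsep / E). *)
Lemma neukirch_uchida_iota_inj :
  neukirch_uchida F -> injective (@comm_iota (gal i)).
Proof.
move=> NU; suff ker g : comm_iota g = 1%g -> g = 1%g.
  move=> g h gh; have : (g * h^-1)%g = 1%g.
    by apply: ker; rewrite comm_iotaM comm_iotaV gh mulgV.
  by move=> /(congr1 (fun k => (k * h)%g)); rewrite mulgVK mul1g.
move=> /comm_classP[W [sW _] gW].
have [E [j [jF WE]]] := open_subgroup_fixer ci sW.
have cj := separable_closure_tower jF ci.
have sE := separable_ext_of_closure jF ci.1.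
have [gI _] := galP g.
have comm_g h a : W h -> h (g a) = g (h a).
  move=> Wh; have := gW h Wh; rewrite /= conj_fun1 => /(congr1 (fun k : gal i => k (g a))).
  by rewrite /= field_isoK.
have jW (h : gal j) : exists2 h' : gal i, W h' & h' =1 h.
  have h'P : `[< is_gal i h >].
    apply/asboolP; split; first by case: (galP h).
    by move=> a; rewrite -jF gal_base.
  by exists (Gal h'P) => //; rewrite WE => a; exact: gal_base.
have id_topiso : topgroup_iso (@idfun (gal j)).
  by split=> // [x|]; [exact: cvg_id|exists idfun => // x; exact: cvg_id].
have isoP (f : Fsep -> Fsep) (fI : field_iso f)
    (fj : f @` range j = range j) (fF : forall a, f (i a) = i a) :
  `[< is_iso_over (in_alg E) (in_alg E) j j f >].
  by apply/asboolP; split=> // a; rewrite jF fF.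
have id1 : idfun @` range j = range j by rewrite image_id.
(* E is the fixed field of [W], and [g] commutes with [W], so [g] preserves E. *)
have gj : g @` range j = range j.
  have fixj x : (forall h, W h -> h x = x) -> range j x.
    move=> fx; apply: (gal_fixed cj) => h; have [h' Wh' <-] := jW h.
    exact: fx.
  apply/seteqP; split=> [_ [_ [a _ <-] <-]|_ [a _ <-]].
    apply: fixj => h Wh; rewrite comm_g//.
    by move: Wh; rewrite WE => ->.
  exists ((g^-1)%g (j a)); last exact: galVK.
  apply: fixj => h Wh; apply: (can_inj (galK g)).
  by rewrite -comm_g// galVK; move: Wh; rewrite WE => ->.
pose a1 := IsoOver (isoP _ (field_iso_id Fsep) id1 (fun=> erefl)).
pose a2 := IsoOver (isoP _ gI gj (gal_base g)).
have [a0 [_ uniq]] := NU E E sE sE Fsep Fsep j j cj cj idfun id_topiso.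
have e1 : a0 = a1.
  apply: uniq; apply/funext => h; apply: gal_eqP => x /=.
  by rewrite inverse_id.
have e2 : a0 = a2.
  apply: uniq; apply/funext => h; apply: gal_eqP => x /=.
  have [h' Wh' hh'] := jW h; rewrite -!hh' -comm_g//.
  by rewrite (field_isoVK gI).
by apply: gal_eqP => x; rewrite -[LHS]/(a2 x) -e2 e1.
Qed.

Lemma neukirch_uchida_iota_surj p :
  neukirch_uchida F -> exists g, comm_class p = comm_iota g.
Proof.
move=> NU.
have [E1 [j1 [jF1 W1]]] := open_subgroup_fixer ci (vdomP p).
have [E2 [j2 [jF2 W2]]] := open_subgroup_fixer ci (vcodP p).
have idI := field_iso_id Fsep.
(* Transport along the identity of [Fsep] views the same automorphisms over [E1] or over [F]. *)
pose T1 := gal_push (b := idfun) idI jF1; pose S1 := gal_pull j1 (i := i) idfun.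
pose T2 := gal_push (b := idfun) idI jF2; pose S2 := gal_pull j2 (i := i) idfun.
have U1 h : vdom p h -> gal_fixer i (idfun \o j1) h by rewrite W1.
have U2 h : vcod p h -> gal_fixer i (idfun \o j2) h by rewrite W2.
have T1in k : vdom p (T1 k) by rewrite W1; exact: gal_push_in.
have T2in k : vcod p (T2 k) by rewrite W2; exact: gal_push_in.
have S1K h : vdom p h -> T1 (S1 h) = h by rewrite W1; exact: gal_pullK.
have S2K h : vcod p h -> T2 (S2 h) = h by rewrite W2; exact: gal_pullK.
have T1K k : S1 (T1 k) = k by exact: gal_pushK.
have T2K k : S2 (T2 k) = k by exact: gal_pushK.
have S1c h : vdom p h -> {for h, continuous S1}.
  by have [] := vdomP p; rewrite W1 => oU _ _ Uh; exact: gal_pull_continuous.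
have S2c h : vcod p h -> {for h, continuous S2}.
  by have [] := vcodP p; rewrite W2 => oU _ _ Uh; exact: gal_pull_continuous.
pose sigma := S2 \o p \o T1; pose tau := S1 \o virtual_inv p \o T2.
have sigma_iso : topgroup_iso sigma.
  split.
  - move=> g h; rewrite /sigma /= [T1 _]gal_pushM vfunM//.
    by apply: (gal_pullM idI jF2); apply: U2; exact: vfun_cod.
  - move=> g; apply: continuous_comp; first exact: gal_push_continuous.
    by apply: continuous_comp; [exact: vfun_cont|apply: S2c; exact: vfun_cod].
  - exists tau.
      split=> g; rewrite /sigma /tau /=.
        by rewrite S2K ?vfunK//; exact: vfun_cod.
      by rewrite S1K ?vinvK//; exact: vinv_dom.
    move=> g; apply: continuous_comp; first exact: gal_push_continuous.
    by apply: continuous_comp; [exact: vinv_cont|apply: S1c; exact: vinv_dom].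
have [alpha [sigmaE _]] := NU E1 E2 (separable_ext_of_closure jF1 ci.1)
  (separable_ext_of_closure jF2 ci.1) Fsep Fsep j1 j2
  (separable_closure_tower jF1 ci) (separable_closure_tower jF2 ci)
  sigma sigma_iso.
have [aI aE aF] := iso_overP alpha.
(* [alpha] is an automorphism of [Fsep] that is the identity on [F], hence an element of the
   absolute Galois group. *)
have aP : `[< is_gal i alpha >].
  by apply/asboolP; split=> // a; rewrite -{1}jF1 aF jF2.
exists (Gal aP); apply/comm_classP; apply: (virtual_eqI (vdomP p)) => h ph _ _.
have {}sigmaE := congr1 (fun s => s (S1 h)) sigmaE.
rewrite /sigma /= S1K// in sigmaE.
rewrite -[LHS]S2K; last exact: vfun_cod.
rewrite sigmaE; apply: gal_eqP => x /=.
rewrite inverse_id (gal_pullE idI); last exact: U1.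
by rewrite inverse_id.
Qed.

(** The Neukirch-Uchida property ranges over all separable closures of [E], while hyperrigidity
    concerns [Fsep]. Embedding [E] in [Fsep] makes [Fsep] a separable closure of [E], and [b] comes
    from uniqueness. *)
Lemma finite_ext_transport (E : fieldExtType F) (K : fieldType)
    (i' : {rmorphism E -> K}) :
  separable 1 {:E} -> separable_closure i' ->
  exists b : K -> Fsep, [/\ field_iso b, forall a, b (i' (in_alg E a)) = i a &
    open_subgroup (gal_fixer i (b \o i'))].
Proof.
move=> sE c'; have [j jF] :=
  separable_embedding i (separable_ext_separable_over sE) ci.2.
have [b bI bj] := separable_closure_unique c' (separable_closure_tower jF ci).
exists b; split=> // [a|]; first by rewrite bj jF.
have -> : b \o i' = j by apply/funext => a /=; exact: bj.
exact: finite_gal_fixer_open_subgroup jF.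
Qed.

Lemma rigid_neukirch_uchida : injective (@comm_iota (gal i)) ->
  (forall p, exists g, comm_class p = comm_iota g) -> neukirch_uchida F.
Proof.
move=> iI iS E1 E2 s1 s2 K1 K2 i1 i2 c1 c2 sigma.
move=> [sigmaM sigmaC [tau [sigmaK tauK] tauC]].
have [b1 [bI1 bF1 oU1]] := finite_ext_transport s1 c1.
have [b2 [bI2 bF2 oU2]] := finite_ext_transport s2 c2.
pose T1 := gal_push bI1 bF1; pose S1 := gal_pull i1 (i := i) b1.
pose T2 := gal_push bI2 bF2; pose S2 := gal_pull i2 (i := i) b2.
set U1 := gal_fixer i (b1 \o i1) in oU1.
set U2 := gal_fixer i (b2 \o i2) in oU2.
have T1in k : U1 (T1 k) by exact: gal_push_in.
have T2in k : U2 (T2 k) by exact: gal_push_in.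
have S1K h : U1 h -> T1 (S1 h) = h by exact: gal_pullK.
have S2K h : U2 h -> T2 (S2 h) = h by exact: gal_pullK.
have T1K k : S1 (T1 k) = k by exact: gal_pushK.
have T2K k : S2 (T2 k) = k by exact: gal_pushK.
have phiP : is_virtual_aut U1 U2 (T2 \o sigma \o S1).
  apply: (@is_virtual_autI _ _ _ _ (T1 \o tau \o S2)) => //=.
  - by move=> h Uh; rewrite T2K sigmaK S1K.
  - by move=> h Uh; rewrite T1K tauK S2K.
  - by move=> g h Ug Uh; rewrite /S1 (gal_pullM bI1 bF1)// sigmaM [T2 _]gal_pushM.
  - move=> h Uh; apply: continuous_comp.
      by apply: gal_pull_continuous => //; case: oU1.
    by apply: continuous_comp; [exact: sigmaC|exact: gal_push_continuous].
  - move=> h Uh; apply: continuous_comp.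
      by apply: gal_pull_continuous => //; case: oU2.
    by apply: continuous_comp; [exact: tauC|exact: gal_push_continuous].
pose p := VirtualAut phiP.
have [g pg] := iS p.
(* The class of [p] only controls a smaller subgroup; [comm_iotaJ] and injectivity of [comm_iota]
   give the relation on all of [U1]. *)
have gsigma k : (g * T1 k = T2 (sigma k) * g)%g.
  apply: iI; rewrite !comm_iotaM -pg comm_iotaJ//=.
  by rewrite T1K.
pose alpha := inverse b2 \o g \o b1.
have aI : field_iso alpha.
  apply: field_iso_comp => //; apply: field_iso_comp.
    exact: field_iso_inverse.
  by case: (galP g).
have alphaJ (k : gal i1) x : alpha (k x) = sigma k (alpha x).
  have := congr1 (fun h : gal i => h (b1 x)) (gsigma k).
  by rewrite /= field_isoK// /alpha /= => ->; rewrite field_isoK.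
have aP : `[< is_iso_over (in_alg E1) (in_alg E2) i1 i2 alpha >].
  apply/asboolP; split=> //.
    (* [E1] and [E2] are fixed fields, and [alpha] intertwines the two Galois actions, so it carries
       one onto the other. *)
    apply/seteqP; split=> [_ [_ [a _ <-] <-]|_ [a _ <-]].
      apply: (gal_fixed c2) => k; rewrite -[k]tauK -alphaJ.
      by rewrite gal_base.
    exists (inverse alpha (i2 a)); last exact: field_isoVK.
    apply: (gal_fixed c1) => k; apply: (can_inj (field_isoK aI)).
    by rewrite alphaJ field_isoVK// gal_base.
  by move=> a; rewrite /alpha /= bF1 gal_base -bF2 field_isoK.
exists (IsoOver aP); split.
  apply/funext => k; apply: gal_eqP => x /=.
  by rewrite -[RHS]/(alpha (k (inverse alpha x))) alphaJ field_isoVK.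
move=> alpha' sigmaE; have [aI' _ aF'] := iso_overP alpha'.
(* For uniqueness, [alpha'] is transported to an element [g'] whose conjugation also agrees with [p]
   on [U1]; injectivity of [comm_iota] then forces g = g'. *)
have gP' : `[< is_gal i (b2 \o alpha' \o inverse b1) >].
  apply/asboolP; split=> [|a].
    apply: field_iso_comp; last exact: field_iso_inverse.
    exact: field_iso_comp.
  by rewrite /= -bF1 field_isoK// aF' bF2.
pose g' := Gal gP'.
have gg' : g = g'.
  apply: iI; rewrite -pg; apply/comm_classP.
  apply: (virtual_eqI oU1) => h Uh _ _ /=.
  rewrite -{2}(S1K h Uh) sigmaE; apply: (mulIg g').
  rewrite /conj_fun mulgVK; apply: gal_eqP => x /=.
  by rewrite !field_isoK.
apply: val_inj; apply/funext => x /=.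
by rewrite /alpha /= gg' /= !field_isoK.
Qed.

End NeukirchUchida.

Theorem proposition6p1 (F Fsep : fieldType) (i : {rmorphism F -> Fsep})
    (hFsep : separable_closure i) :
  neukirch_uchida F <-> hyperrigid_field i.
Proof.
rewrite /hyperrigid_field hyperrigid_galP; split=> [NU|[iI iS]].
  split; first exact: neukirch_uchida_iota_inj.
  by move=> p; exact: neukirch_uchida_iota_surj.
exact: rigid_neukirch_uchida iI iS.
Qed.
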